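(* Let $k\ge1$ and $0\le j\le k$ be integers. Then $$\mathbb{E}(k,j)=\begin{cases}E(k,j)&(k\text{ odd}),\\ F(k,j)&(k\text{ even}).\end{cases}$$
   Context: $\mathbb{E}(k,j)$ (Entringer number) is the number of permutations $\sigma\in\mathfrak{S}_{k+1}$ with $\sigma(1)=j+1$ that are down-up, i.e. for $1\le i\le k$: $\sigma(i)<\sigma(i+1)$ if and only if $i$ is even. $E_n$ are the Euler numbers, $\sum_{n\ge0}E_n\frac{X^n}{n!}=\frac{2}{e^X+e^{-X}}$. $F_n:=(2^{n+1}-4^{n+1})B_{n+1}/(n+1)$ with $B_n$ the Bernoulli numbers ($\sum_{n\ge 0} B_nX^n/n!=X/(e^X-1)$); equivalently $\sum_{n\ge0}F_n\frac{X^n}{n!}=\frac{2e^{-X}}{e^X+e^{-X}}$. For integers $0\le j\le k$: $$E(k,j)=(-1)^{\lfloor (k-1)/2\rfloor}\sum_{n=1}^{j}\binom{j}{n}E_{k-n},\qquad F(k,j)=(-1)^{\lfloor k/2\rfloor}\sum_{n=1}^{j}\binom{j}{n}F_{k-n}.$$ *)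

(* Defs.v *)
From mathcomp Require Import all_boot all_order all_algebra all_fingroup.

Set Implicit Arguments.
Unset Strict Implicit.
Unset Printing Implicit Defensive.

Import GRing.Theory.
Local Open Scope ring_scope.

(* Values and positions are 0-based: the i-th position (1 <= i <= k) of a
   permutation of {1, .., k+1} is the index i - 1 of 'I_k.+1, and the condition
   "the first value is j + 1" becomes [s ord0 = j]. *)
Definition down_up (k : nat) (s : 'S_k.+1) : bool :=
  [forall i : 'I_k,
     (s (widen_ord (leqnSn k) i) < s (lift ord0 i))%N == ~~ odd i.+1].

Definition entringer (k j : nat) : nat :=
  #|[set s : 'S_k.+1 | ((s ord0 : nat) == j) && down_up s]|.

(* A formal power series over rat is its sequence of coefficients. *)
Definition fps := nat -> rat.

Definition fps_mul (f g : fps) : fps :=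
  fun n => \sum_(i < n.+1) f i * g (n - i)%N.

(* First n coefficients of f / g; meaningful when g 0 != 0, see fps_divK. *)
Fixpoint fps_div_seq (f g : fps) (n : nat) : seq rat :=
  if n is m.+1 then
    let q := fps_div_seq f g m in
    rcons q ((f m - \sum_(i < m) q`_i * g (m - i)%N) / g 0%N)
  else [::].

Definition fps_div (f g : fps) : fps := fun n => (fps_div_seq f g n.+1)`_n.

Definition fps_const (c : rat) : fps := fun n => if n is 0%N then c else 0.
Definition fps_X : fps := fun n => (n == 1%N)%:R.
Definition fps_add (f g : fps) : fps := fun n => f n + g n.
Definition fps_sub (f g : fps) : fps := fun n => f n - g n.

(* e^(c X) *)
Definition fps_exp (c : rat) : fps := fun n => c ^+ n / n`!%:R.

(* Division by X of a series with zero constant term. *)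
Definition fps_shift (f : fps) : fps := fun n => f n.+1.

Definition egf (a : nat -> rat) : fps := fun n => a n / n`!%:R.

(* sum_n E_n X^n / n! = 2 / (e^X + e^(-X)) *)
Definition euler_num (n : nat) : rat :=
  n`!%:R * fps_div (fps_const 2) (fps_add (fps_exp 1) (fps_exp (-1))) n.

(* sum_n B_n X^n / n! = X / (e^X - 1), computed as 1 / ((e^X - 1) / X) since
   e^X - 1 has no constant term; see egf_bernoulli. *)
Definition bernoulli_num (n : nat) : rat :=
  n`!%:R *
  fps_div (fps_const 1) (fps_shift (fps_sub (fps_exp 1) (fps_const 1))) n.

Definition F_num (n : nat) : rat :=
  (2 ^+ n.+1 - 4 ^+ n.+1) * bernoulli_num n.+1 / n.+1%:R.

(* The truncated k.-1 only matters at k = 0, where j <= k makes the sum empty;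
   likewise k - n is never truncated for n <= j <= k. *)
Definition E_kj (k j : nat) : rat :=
  (-1) ^+ (k.-1)./2 *
  \sum_(1 <= n < j.+1) 'C(j, n)%:R * euler_num (k - n)%N.

Definition F_kj (k j : nat) : rat :=
  (-1) ^+ k./2 *
  \sum_(1 <= n < j.+1) 'C(j, n)%:R * F_num (k - n)%N.

Lemma size_fps_div_seq f g n : size (fps_div_seq f g n) = n.
Proof. by elim: n => //= n IHn; rewrite size_rcons IHn. Qed.

Lemma nth_fps_div_seq f g n i :
  (i < n)%N -> (fps_div_seq f g n)`_i = fps_div f g i.
Proof.
elim: n => // n IHn; rewrite ltnS leq_eqVlt => /orP[/eqP->// | ltin] /=.
by rewrite nth_rcons size_fps_div_seq ltin IHn.
Qed.

Lemma fps_divK f g : g 0%N != 0 -> fps_mul (fps_div f g) g =1 f.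
Proof.
move=> g0 n; rewrite /fps_mul big_ord_recr /= subnn {2}/fps_div /=.
rewrite nth_rcons size_fps_div_seq ltnn eqxx divfK //.
rewrite (eq_bigr (fun i : 'I_n => (fps_div_seq f g n)`_i * g (n - i)%N)).
  by rewrite addrC subrK.
by move=> i _; rewrite nth_fps_div_seq.
Qed.

Lemma fact_neq0 n : n`!%:R != 0 :> rat.
Proof. by rewrite Num.Theory.pnatr_eq0 -lt0n fact_gt0. Qed.

Lemma egf_fact (q : fps) n : egf (fun m => m`!%:R * q m) n = q n.
Proof. by rewrite /egf mulrAC divff ?mul1r ?fact_neq0. Qed.

Lemma egf_euler :
  fps_mul (egf euler_num) (fps_add (fps_exp 1) (fps_exp (-1))) =1 fps_const 2.
Proof.
move=> n; rewrite -[RHS](@fps_divK _ (fps_add (fps_exp 1) (fps_exp (-1)))) //.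
by apply: eq_bigr => i _; rewrite egf_fact.
Qed.

Lemma egf_bernoulli :
  fps_mul (egf bernoulli_num) (fps_sub (fps_exp 1) (fps_const 1)) =1 fps_X.
Proof.
case=> [|n]; first by rewrite /fps_mul big_ord1 /= mulr0.
rewrite /fps_mul big_ord_recr /= subnn.
have -> : fps_sub (fps_exp 1) (fps_const 1) 0%N = 0 by [].
rewrite mulr0 addr0.
transitivity (fps_const 1 n); last by case: n.
rewrite -[RHS](@fps_divK _
  (fps_shift (fps_sub (fps_exp 1) (fps_const 1)))) //.
apply: eq_bigr => i _.
by rewrite egf_fact subSn // -ltnS.
Qed.

(* Main.v *)
(* Deleting the first value of a down-up permutation and reversing the order of
   the remaining values shows that e(k+1, j) counts the down-up permutations in
   S_{k+1} whose first value exceeds k+1-j, hence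
     e(k+1, j+1) = e(k+1, j) + e(k, k-j)
   for the Entringer numbers e(k, j).  For the right-hand sides, let L be the linear
   functional on polynomials sending X^n to the Euler number E_n.  The generating
   function of the E_n says that L is even and that
     L((X+1)^n + (X-1)^n) = 2 [n = 0],
   and e^(FX) = e^((E-1)X) says that F_n = L((X-1)^n).  Up to signs both sums
   become values of L on products of powers of X and X +- 1, and the recurrence
   follows from the evenness of L together with E_n = 0 for n odd and F_n = 0 for
   n > 0 even. *)
Require Import Defs.
From mathcomp Require Import all_boot all_order all_algebra all_fingroup.
From HB Require Import structures.
From mathcomp Require Import zify ring lra.

Set Implicit Arguments.
Unset Strict Implicit.

Import GRing.Theory.

(** * Down-up permutations by first value: the Entringer recurrence *)

Definition insert_head (k : nat) (j : 'I_k.+2) (t : 'S_k.+1) : 'S_k.+2 :=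
  lift_perm ord0 j (t * perm (@rev_ord_inj k.+1)).

Lemma insert_head0 k (j : 'I_k.+2) t : insert_head j t ord0 = j.
Proof. exact: lift_perm_id. Qed.

Lemma insert_head_lift k (j : 'I_k.+2) t i :
  insert_head j t (lift ord0 i) = lift j (rev_ord (t i)).
Proof. by rewrite /insert_head lift_perm_lift permM permE. Qed.

Lemma insert_head_inj k (j : 'I_k.+2) : injective (insert_head j).
Proof.
move=> t u eq_tu; apply/permP => i.
apply/rev_ord_inj/(@lift_inj _ j).
by rewrite -!insert_head_lift eq_tu.
Qed.

Lemma insert_head_surj k j (s : 'S_k.+2) :
  s ord0 = j -> exists t, s = insert_head j t.
Proof.
move=> s0.
have neq i : j != s (lift ord0 i).
  by rewrite -s0 (inj_eq perm_inj) neq_lift.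
(* By [neq], [unlift] never fails here, so the default [ord0] is never returned. *)
pose f i := rev_ord (odflt ord0 (unlift j (s (lift ord0 i)))).
have fK i : lift j (rev_ord (f i)) = s (lift ord0 i).
  by rewrite /f rev_ordK; case: unliftP (neq i) => [h -> //|->]; rewrite eqxx.
have f_inj : injective f.
  move=> x y eq_f; apply/(@lift_inj _ ord0)/(@perm_inj _ s).
  by rewrite -!fK eq_f.
exists (perm f_inj); apply/permP => i.
case: (unliftP ord0 i) => [h|] ->; last by rewrite insert_head0.
by rewrite insert_head_lift permE fK.
Qed.

Lemma insert_head_ascent k (j : 'I_k.+2) t (i : 'I_k) :
  (insert_head j t (widen_ord (leqnSn k.+1) (lift ord0 i)) <
   insert_head j t (lift ord0 (lift ord0 i)))%N =
  ~~ (t (widen_ord (leqnSn k) i) < t (lift ord0 i))%N.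
Proof.
have -> : widen_ord (leqnSn k.+1) (lift ord0 i) =
          lift ord0 (widen_ord (leqnSn k) i) by exact: val_inj.
rewrite !insert_head_lift /= /bump.
(* Reversing values turns [<] into [>]; since [t] is injective, equality is excluded and [>] is the
   negation of [<]. *)
have : t (widen_ord (leqnSn k) i) != t (lift ord0 i).
  by rewrite (inj_eq perm_inj) -val_eqE /= /bump /=; lia.
rewrite -val_eqE /=.
have := ltn_ord (t (widen_ord (leqnSn k) i)).
have := ltn_ord (t (lift ord0 i)).
lia.
Qed.

Lemma insert_head_ascent0 k (j : 'I_k.+2) t :
  (insert_head j t (widen_ord (leqnSn k.+1) ord0) <
   insert_head j t (lift ord0 ord0))%N = ~~ (rev_ord (t ord0) < j)%N.
Proof.
have -> : widen_ord (leqnSn k.+1) ord0 = ord0 by apply: val_inj.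
rewrite insert_head0 insert_head_lift /= /bump; lia.
Qed.

(** Moving the tail one position flips the required parity, and [rev_ord] flips the ascents, so the
    tail condition is again [down_up t]; only the initial descent involves [j]. *)
Lemma down_up_insert_head k (j : 'I_k.+2) t :
  down_up (insert_head j t) = (rev_ord (t ord0) < j)%N && down_up t.
Proof.
apply/forallP/andP => [H | [t0 /forallP H] i].
  split; first by move: (H ord0); rewrite insert_head_ascent0 => /eqP/negbFE.
  apply/forallP => i; move: (H (lift ord0 i)).
  by rewrite insert_head_ascent /= (inj_eq negb_inj) negbK.
case: (unliftP ord0 i) => [h|] ->; last by rewrite insert_head_ascent0 t0.
by rewrite insert_head_ascent /= (inj_eq negb_inj) (eqP (H h)) /= negbK.
Qed.

Lemma entringer_card k j : (j <= k.+1)%N ->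
  entringer k.+1 j = #|[set t : 'S_k.+1 | (k - t ord0 < j)%N && down_up t]|.
Proof.
move=> lejk; pose j' := Ordinal (lejk : (j < k.+2)%N).
rewrite /entringer -(card_imset _ (@insert_head_inj _ j')).
apply: eq_card => s; rewrite !inE; apply/andP/imsetP => [[/eqP s0 dus]|[t]].
  have /insert_head_surj[t Es] : s ord0 = j' by apply: val_inj.
  by exists t => //; move: dus; rewrite Es down_up_insert_head inE /= subSS.
rewrite inE -[(k - _)%N]subSS => H ->.
by rewrite down_up_insert_head insert_head0.
Qed.

Lemma entringerS0 k : entringer k.+1 0 = 0%N.
Proof. by rewrite entringer_card //; apply: eq_card0 => s; rewrite inE. Qed.

(** The bound [k - t ord0 < j.+1] splits into the disjoint cases [k - t ord0 < j] and
    [t ord0 = k - j]. *)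
Lemma entringerSS k j : (j <= k)%N ->
  entringer k.+1 j.+1 = (entringer k.+1 j + entringer k (k - j))%N.
Proof.
move=> lejk; rewrite !entringer_card //; last exact: leqW.
rewrite -cardsUI (_ : _ :&: _ = set0) ?cards0 ?addn0.
  apply: eq_card => t; rewrite !inE -andb_orl; congr (_ && _).
  by have := ltn_ord (t ord0); lia.
apply/setP => t; rewrite !inE; have := ltn_ord (t ord0); lia.
Qed.

Lemma entringer00 : entringer 0 0 = 1%N.
Proof.
rewrite /entringer -[RHS](card_Sn 1).
apply: eq_card => s; rewrite !inE ord1 /=; apply/forallP; case=> [] //.
Qed.

Local Open Scope ring_scope.

(** * Umbral functionals on polynomials *)

Definition umbral (a : nat -> rat) (p : {poly rat}) : rat :=
  \sum_(i < size p) p`_i * a i.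

Lemma umbral_widen a (p : {poly rat}) n :
  (size p <= n)%N -> umbral a p = \sum_(i < n) p`_i * a i.
Proof.
move=> le; rewrite /umbral (big_ord_widen n (fun i => p`_i * a i) le).
rewrite big_mkcond; apply: eq_bigr => i _.
by case: ltnP => // ?; rewrite nth_default // mul0r.
Qed.

Lemma umbral_is_linear a : linear_for *%R (umbral a).
Proof.
move=> c p q.
rewrite !(@umbral_widen _ _ (maxn (size p) (size q))) ?leq_maxl ?leq_maxr //.
  rewrite big_distrr -big_split; apply: eq_bigr => i _ /=.
  by rewrite coefD coefZ mulrDl mulrA.
apply: leq_trans (size_polyD _ _) _.
by rewrite geq_max leq_maxr (leq_trans (size_scale_leq _ _)) ?leq_maxl.
Qed.

HB.instance Definition _ a :=
  GRing.isLinear.Build rat {poly rat} rat *%R (umbral a) (umbral_is_linear a).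

Lemma umbralXn a n : umbral a 'X^n = a n.
Proof.
rewrite /umbral size_polyXn big_ord_recr /= big1 ?add0r.
  by rewrite coefXn eqxx mul1r.
by move=> i _; rewrite coefXn (ltn_eqF (ltn_ord i)) mul0r.
Qed.

(** Subtracting a multiple of [q] lowers the degree, so one test polynomial per degree suffices;
    later proofs choose it to fit a functional equation. *)
Lemma linear_functional_ext (K : fieldType)
    (f g : {linear {poly K} -> K | *%R}) :
  (forall n, exists2 q : {poly K}, size q = n.+1 & f q = g q) -> f =1 g.
Proof.
move=> H p; elim: {p}(size p) {-2}p (leqnn (size p)) => [|n IHn] p.
  by rewrite leqn0 size_poly_eq0 => /eqP ->; rewrite !raddf0.
move=> sp; have [q sq eq_q] := H n.
have q0 : q`_n != 0.
  have: lead_coef q != 0 by rewrite lead_coef_eq0 -size_poly_eq0 sq.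
  by rewrite lead_coefE sq.
have /IHn : (size (p - (p`_n / q`_n) *: q)%R <= n)%N.
  apply/leq_sizeP => i; rewrite leq_eqVlt coefB coefZ => /orP[/eqP <-|lt].
    by rewrite divfK // subrr.
  rewrite (nth_default 0 (leq_trans sp lt)) [q`_i]nth_default ?sq //.
  by rewrite mulr0 subrr.
by rewrite !linearB !linearZ /= eq_q => /addIr.
Qed.

Lemma size_XaddCn (R : idomainType) (c : R) n : size (('X + c%:P) ^+ n) = n.+1.
Proof. by rewrite -[c]opprK polyCN size_exp_XsubC. Qed.

Lemma umbral_translate a (c : rat) n :
  umbral a (('X + c%:P) ^+ n) =
  \sum_(i < n.+1) 'C(n, i)%:R * (c ^+ (n - i) * a i).
Proof.
rewrite addrC exprDn raddf_sum; apply: eq_bigr => i _ /=.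
rewrite -polyC_exp mul_polyC raddfMn /= linearZ /= umbralXn.
by rewrite mulr_natl.
Qed.

Lemma bin_fact_rat n i : (i <= n)%N ->
  'C(n, i)%:R = n`!%:R / (i`!%:R * (n - i)`!%:R) :> rat.
Proof.
move=> le; rewrite -(bin_fact le) !natrM mulfK //.
by rewrite mulf_neq0 ?fact_neq0.
Qed.

(** * Generating functions as functional equations *)

Local Notation E := (umbral euler_num).
Local Notation B := (umbral bernoulli_num).
Local Notation F := (umbral F_num).

Lemma euler_umbral n :
  E (('X + 1) ^+ n) + E (('X - 1) ^+ n) = 2 * (n == 0)%:R.
Proof.
have := egf_euler n; rewrite /fps_mul => H.
rewrite -polyC1 -polyCN !umbral_translate -big_split /=.
have -> : 2 * (n == 0%N)%:R = n`!%:R * fps_const 2 n :> rat.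
  by case: n {H} => [|n]; rewrite /= ?mulr1 ?mulr0 // mul1r.
rewrite -H big_distrr /=; apply: eq_bigr => i _.
rewrite bin_fact_rat -1?ltnS // /egf /fps_add /fps_exp invfM.
ring.
Qed.

(** Compare coefficients of X^n in the product with e^X - 1. That factor has no constant term, so
    the term of index n drops out; this matches the subtracted [B 'X^n]. *)
Lemma bernoulli_umbral n :
  B (('X + 1) ^+ n) - B ('X^n) = (n == 1)%:R.
Proof.
have := egf_bernoulli n; rewrite /fps_mul big_ord_recr /= subnn.
rewrite {2}/fps_sub /fps_exp /= subrr mulr0 addr0 => H.
rewrite -polyC1 umbral_translate umbralXn big_ord_recr /=.
rewrite binn subnn expr0 !mul1r addrK.
have -> : (n == 1%N)%:R = n`!%:R * fps_X n :> rat.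
  by case: n {H} => [|[|n]]; rewrite /fps_X /= ?mulr1 ?mulr0 // mul1r.
rewrite -H big_distrr /=; apply: eq_bigr => i _.
rewrite bin_fact_rat ?(ltnW (ltn_ord i)) // /egf /fps_sub /fps_exp invfM.
have : (n - i != 0)%N by rewrite subn_eq0 -ltnNge.
case: (n - i)%N => // m _; rewrite /= subr0.
ring.
Qed.

Lemma umbral_bernoulli p : B (p \Po ('X + 1)) = B p + p^`().[0].
Proof.
pose f := B \o comp_poly ('X + 1).
pose g := B \+ (horner_eval 0 \o deriv).
suff: f =1 g by move=> /(_ p).
apply: linear_functional_ext => n; exists 'X^n; first by rewrite size_polyXn.
rewrite /f /g /= comp_Xn_poly /horner_eval derivXn hornerMn hornerXn.
rewrite -[LHS](subrK (B 'X^n)) bernoulli_umbral addrC; congr (_ + _).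
by case: n => [|[|n]] //=; rewrite exprS mul0r mul0rn.
Qed.

Lemma size_addX1n_subXn (R : numDomainType) n :
  size (('X + 1) ^+ n.+1 - 'X^(n.+1) : {poly R})%R = n.+1.
Proof.
have -> : ('X + 1) ^+ n.+1 - 'X^(n.+1) =
    \poly_(i < n.+1) ('C(n.+1, i)%:R : R).
  rewrite exprD1n big_ord_recr /= binn mulr1n addrK poly_def.
  by apply: eq_bigr => i _; rewrite scaler_nat.
by rewrite size_poly_eq // binSn Num.Theory.pnatr_eq0.
Qed.

Lemma bernoulli_shift2 p :
  B (p \Po (2 *: 'X + 2%:P)) = B (p \Po (2 *: 'X)) + 2 * p^`().[0].
Proof.
have := umbral_bernoulli (p \Po (2 *: 'X)).
rewrite -comp_polyA comp_polyZ comp_polyX scalerDr alg_polyC => ->.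
rewrite deriv_comp hornerM horner_comp derivZ derivX alg_polyC hornerC.
by rewrite hornerZ hornerX mulr0 mulrC.
Qed.

(* Both sides change by twice the derivative at 0 under X -> X + 1, which
   determines a functional because p(X + 1) - p(X) takes every degree. *)
Lemma bernoulli_duplication p :
  B (p \Po (2 *: 'X)) + B (p \Po (2 *: 'X + 1)) = B p + B p.
Proof.
pose f := (B \o comp_poly (2 *: 'X)) \+ (B \o comp_poly (2 *: 'X + 1)).
pose g := B \+ B.
suff: f =1 g by move=> /(_ p).
apply: linear_functional_ext => n.
exists (('X + 1) ^+ n.+1 - 'X^(n.+1)); first exact: size_addX1n_subXn.
rewrite /f /g /= !linearB /= !comp_Xn_poly.
have H := bernoulli_shift2 'X^(n.+1).
have H1 := umbral_bernoulli 'X^(n.+1).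
rewrite !comp_Xn_poly in H H1.
rewrite !rmorphXn /= !comp_polyD !comp_polyX -polyC1 !comp_polyC.
have -> : 2 *: 'X + 1%:P + 1%:P = 2 *: 'X + 2%:P :> {poly rat}.
  by rewrite -addrA -polyCD.
rewrite polyC1 H H1; ring.
Qed.

(** On X^n with n > 0 this reads n F_(n-1) = (2^n - 4^n) B_n, the definition of [F_num]. *)
Lemma F_deriv p : F p^`() = B (p \Po (2 *: 'X)) - B (p \Po (4 *: 'X)).
Proof.
pose f := F \o deriv.
pose g := (B \o comp_poly (2 *: 'X)) \- (B \o comp_poly (4 *: 'X)).
suff: f =1 g by move=> /(_ p).
apply: linear_functional_ext => n; exists 'X^n; first by rewrite size_polyXn.
rewrite /f /g /= !comp_Xn_poly !exprZn !linearZ /= derivXn.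
case: n => [|n]; first by rewrite !expr0 mulr0n raddf0 subrr.
rewrite raddfMn /= !umbralXn /F_num -[LHS]mulr_natr divfK ?mulrBl //.
by rewrite Num.Theory.pnatr_eq0.
Qed.

(** Umbral form of (e^(2X) + 1) * sum F_n X^n / n! = 2, obtained from the Bernoulli identities
    through an antiderivative of [p]. *)
Lemma F_umbral p : F (p \Po ('X + 2%:P)) + F p = 2 * p.[0].
Proof.
have [q ->] : exists q : {poly rat}, p = q^`().
  (* At [i = 0] the division by zero yields 0, the constant of integration. *)
  exists (\poly_(i < (size p).+1) (p`_i.-1 / i%:R)).
  apply/polyP => i; rewrite coef_deriv coef_poly ltnS /=.
  case: ltnP => [_|le]; last by rewrite nth_default // mul0rn.
  by rewrite -[RHS]mulr_natr divfK // Num.Theory.pnatr_eq0.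
have -> : q^`() \Po ('X + 2%:P) = (q \Po ('X + 2%:P))^`().
  by rewrite deriv_comp derivD derivX derivC addr0 mulr1.
rewrite !F_deriv -!comp_polyA.
have -> : ('X + 2%:P) \Po (2 *: 'X) = 2 *: 'X + 2%:P :> {poly rat}.
  by rewrite comp_polyD comp_polyX comp_polyC.
have -> : ('X + 2%:P) \Po (4 *: 'X) = (2 *: 'X) \Po (2 *: 'X + 1) :> {poly rat}.
  rewrite comp_polyZ comp_polyD !comp_polyX comp_polyC.
  by rewrite scalerDr scalerA alg_polyC.
have -> : 4 *: 'X = (2 *: 'X) \Po (2 *: 'X) :> {poly rat}.
  by rewrite comp_polyZ comp_polyX scalerA.
(* Duplication for q(2X) eliminates the values at 4X and 4X + 2, leaving q(2X + 2) against q(2X). *)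
have := bernoulli_duplication (q \Po (2 *: 'X)).
rewrite bernoulli_shift2 -!comp_polyA; lra.
Qed.

(** * Comparison of [F] with [E], and parity *)

Lemma size_monicD (R : numDomainType) (p q : {poly R}) :
  p \is monic -> q \is monic -> size p = size q -> size (p + q)%R = size p.
Proof.
move=> /monicP mp /monicP mq eq_s; apply/eqP; rewrite eqn_leq.
rewrite (leq_trans (size_polyD _ _)) ?eq_s ?maxnn //=.
have: (0 < size q)%N by rewrite lt0n size_poly_eq0 -lead_coef_eq0 mq oner_neq0.
case sq: (size q) => [|n] // _; rewrite ltnNge.
apply/negP => /leq_sizeP/(_ n (leqnn n)); rewrite coefD.
move: mp mq; rewrite !lead_coefE eq_s sq /= => -> ->.
by apply/eqP; rewrite (Num.Theory.pnatr_eq0 R 2).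
Qed.

Lemma monic_XaddCn (R : idomainType) (c : R) n : ('X + c%:P) ^+ n \is monic.
Proof. by rewrite monic_exp // monicXaddC. Qed.

(** On (X+2)^n + X^n, the shift by -1 gives (X+1)^n + (X-1)^n, and both functionals return 2
    [n = 0]. *)
Lemma F_euler p : F p = E (p \Po ('X - 1)).
Proof.
pose f := F; pose g := E \o comp_poly ('X - 1).
suff: f =1 g by move=> /(_ p).
apply: linear_functional_ext => n.
exists (('X + 2%:P) ^+ n + 'X^n).
  rewrite size_monicD ?monic_XaddCn ?monicXn //= size_XaddCn //.
  by rewrite size_polyXn.
rewrite /f /g /= !linearD /= -{1}(comp_Xn_poly ('X + 2%:P)) F_umbral hornerXn.
rewrite rmorphXn /= comp_polyD comp_polyX comp_polyC comp_Xn_poly.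
have -> : 'X - 1 + 2%:P = 'X + 1 :> {poly rat}.
  by rewrite (_ : 2 = 1 + 1) // polyCD; ring.
by rewrite euler_umbral expr0n.
Qed.

(** The substitution multiplies (X+1)^n + (X-1)^n by (-1)^n, while [E] vanishes on it unless n =
    0. *)
Lemma euler_even p : E (p \Po (- 'X)) = E p.
Proof.
pose f := E \o comp_poly (- 'X); pose g := E.
suff: f =1 g by move=> /(_ p).
apply: linear_functional_ext => n.
exists (('X + 1) ^+ n + ('X - 1) ^+ n).
  rewrite -polyC1 -polyCN.
  by rewrite size_monicD ?monic_XaddCn ?size_XaddCn.
transitivity (E ((-1) ^+ n *: (('X + 1) ^+ n + ('X - 1) ^+ n))).
  rewrite /f /=; congr (E _).
  rewrite rmorphD !rmorphXn /= -polyC1.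
  rewrite !(comp_polyD, comp_polyB, comp_polyX, comp_polyC).
  rewrite scalerDr -!exprZn addrC.
  by congr (_ ^+ _ + _ ^+ _); rewrite scaleN1r; ring.
rewrite linearZ /= linearD /= euler_umbral.
by case: n => [|n]; rewrite ?mulr0 ?expr0 ?mul1r.
Qed.

Lemma euler_reflection a b :
  E (('X + 1) ^+ a * 'X^b) = (-1) ^+ (a + b) * E (('X - 1) ^+ a * 'X^b).
Proof.
rewrite -euler_even rmorphM !rmorphXn /= comp_polyD !comp_polyX.
rewrite -polyC1 comp_polyC.
have -> : (- 'X + 1%:P : {poly rat}) = -1 *: ('X - 1%:P).
  by rewrite scaleN1r; ring.
by rewrite -[- 'X]scaleN1r !exprZn -scalerAl -scalerAr scalerA -exprD linearZ.
Qed.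

Lemma euler0 : euler_num 0 = 1.
Proof.
by have := euler_umbral 0; rewrite !expr0 -(expr0 'X) umbralXn /=; lra.
Qed.

Lemma euler_odd n : odd n -> euler_num n = 0.
Proof.
move=> odd_n; have := euler_reflection 0 n.
rewrite !expr0 !mul1r umbralXn -signr_odd odd_n; lra.
Qed.

(** For even n, reflection equates the two terms of [euler_umbral], whose sum is 0; one of them is
    F_n. *)
Lemma F_even n : (0 < n)%N -> ~~ odd n -> F_num n = 0.
Proof.
move=> n0 even_n; rewrite -(umbralXn F_num) F_euler comp_Xn_poly.
have := euler_umbral n; have := euler_reflection n 0.
rewrite !expr0 !mulr1 addn0 -signr_odd (negPf even_n) (gtn_eqF n0).
rewrite expr0 /= mulr0; lra.
Qed.

(** * The two sums as umbral values, and their recurrences *)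

Lemma umbral_binomial a k j : (j <= k)%N ->
  \sum_(1 <= n < j.+1) 'C(j, n)%:R * a (k - n)%N =
  umbral a (('X + 1) ^+ j * 'X^(k - j)) - a k.
Proof.
move=> lejk; have -> : umbral a (('X + 1) ^+ j * 'X^(k - j)) =
    \sum_(0 <= n < j.+1) 'C(j, n)%:R * a (k - n)%N.
  rewrite exprDn big_distrl /= linear_sum big_mkord; apply: eq_bigr => i _.
  rewrite expr1n mulr1 mulr_natl mulrnAl -exprD raddfMn /= umbralXn.
  by congr (a _ *+ _); have := ltn_ord i; lia.
by rewrite [in RHS]big_ltn // bin0 mul1r subn0 addrC addKr.
Qed.

Lemma E_kj_umbral k j : (j <= k)%N ->
  E_kj k j =
  (-1) ^+ (k.-1)./2 * (E (('X + 1) ^+ j * 'X^(k - j)) - euler_num k).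
Proof. by move=> lejk; rewrite /E_kj umbral_binomial. Qed.

Lemma F_kj_umbral k j : (j <= k)%N ->
  F_kj k j =
  (-1) ^+ k./2 * (E (('X - 1) ^+ (k - j) * 'X^j) - F_num k).
Proof.
move=> lejk; rewrite /F_kj umbral_binomial // F_euler rmorphM !rmorphXn /=.
rewrite -polyC1 comp_polyD !comp_polyX comp_polyC addrNK.
by rewrite [_ * 'X^j]mulrC.
Qed.

(** After reflection, all reduces to (X+1)^(j+1) X^(k-j) = (X+1)^j X^(k-j+1) + (X+1)^j X^(k-j). *)
Lemma E_kj_rec k j : (0 < k)%N -> ~~ odd k -> (j <= k)%N ->
  E_kj k.+1 j.+1 = E_kj k.+1 j + F_kj k (k - j).
Proof.
move=> k0 even_k lejk.
rewrite (@E_kj_umbral _ j.+1) // (E_kj_umbral (leqW lejk)).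
rewrite F_kj_umbral ?leq_subr // F_even // subr0 subKn //.
rewrite subSS subSn // /= -mulrDr; congr (_ * _).
have := euler_reflection j (k - j).
rewrite subnKC // -signr_odd (negPf even_k) mul1r => <-.
rewrite addrAC -linearD; congr (E _ - _).
rewrite !exprS; ring.
Qed.

(** Here the identity is (X-1)^(k-j) X^(j+1) = (X-1)^(k-j+1) X^j + (X-1)^(k-j) X^j. *)
Lemma F_kj_rec k j : odd k -> (j <= k)%N ->
  F_kj k.+1 j.+1 = F_kj k.+1 j + E_kj k (k - j).
Proof.
move=> odd_k lejk.
rewrite (@F_kj_umbral _ j.+1) // (F_kj_umbral (leqW lejk)).
rewrite E_kj_umbral ?leq_subr // euler_odd // subr0 subKn //.
rewrite subSS subSn //; have := euler_reflection (k - j) j.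
rewrite subnK // -signr_odd odd_k expr1 mulN1r => ->.
(* This sign change absorbs the minus sign of the reflection in odd degree. *)
have -> : (-1) ^+ (k.-1)./2 = - (-1) ^+ (k.+1)./2 :> rat.
  by case: k odd_k {lejk} => // k _; rewrite /= exprS mulN1r opprK.
rewrite mulrNN -mulrDr; congr (_ * _).
rewrite addrAC -linearD; congr (E _ - _).
rewrite !exprS; ring.
Qed.

Theorem theorem7 (k j : nat) (hk : (1 <= k)%N) (hj : (j <= k)%N) :
  (entringer k j)%:R = (if odd k then E_kj k j else F_kj k j) :> rat.
Proof.
(* Induction on k, then on j. [E_kj_rec] starts at positive k, so k = 1 is computed from
   [entringer00]; at j = 0 both sides vanish. *)
case: k hk hj => // k _; elim: k j => [|k IHk].
  case=> [|[|j]] // _; first by rewrite entringerS0 /E_kj big_geq // mulr0.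
  rewrite entringerSS // entringerS0 entringer00 /E_kj big_nat1.
  by rewrite subnn euler0 bin1 mul1r.
elim=> [|j IHj] lejk.
  by rewrite entringerS0 /E_kj /F_kj !big_geq // !mulr0 if_same.
rewrite entringerSS // natrD IHj ?(ltnW lejk) // IHk ?leq_subr //.
have -> : odd k.+2 = ~~ odd k.+1 by [].
by case: (boolP (odd k.+1)) => odd_k; [rewrite F_kj_rec | rewrite E_kj_rec].
Qed.
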